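(* Consider the regime $\beta=0$. The equilibrium price in the duopoly game with payoffs $\mathcal M_i(\cdot,\cdot;0)$ is less than or equal to the optimal monopoly price $\phi^{\mathrm{mon}}$ (where, when $f(\phi_b)/2<\rho<1$ and the equilibrium is the mixed equilibrium $(\sigma^*,\sigma^* )$, or the equilibrium cycle, this means that every point of $[\phi_L^*,\phi_R^*]$ is at most $\phi^{\mathrm{mon}}$). Moreover, the optimal platform payoff $\max_{\phi}\mathcal M(\phi;0)$ in the monopoly scenario is always greater than or equal to the equilibrium payoff of each platform in the duopoly game. For $\rho\ge1$ the duopoly equilibrium price and platform payoff are taken to be zero in this comparison.
   Context: Fix $\phi_h>0$ and $f:[0,\phi_h]\to\mathbb R$ strictly concave, strictly decreasing and differentiable, with $0<f(\phi)\le 1$ for all $\phi$ and $f(0)=1$. Fix $\Lambda>0$, $e>0$, $\rho:=e/\Lambda$. The extended inverse $f^{-1}:[0,\infty)\to[0,\phi_h]$: $f^{-1}(x)=\phi_h$ for $0\le x<f(\phi_h)$; the unique $\phi$ with $f(\phi)=x$ for $f(\phi_h)\le x\le1$; $0$ for $x>1$. Monopoly ($\beta=0$): $\mathcal M(\phi;0)=e\phi$ if $f(\phi)>2\rho$, and $\frac{\Lambda}{2}f(\phi)\phi$ otherwise; $\phi^{\mathrm{mon}}$ is its unique maximizer over $[0,\phi_h]$: with $\phi_m:=\max\{\phi\in[0,\phi_h]:f(\phi)+\phi f'(\phi)\ge0\}$, $\phi^{\mathrm{mon}}=f^{-1}(2\rho)$ if $\rho\le f(\phi_m)/2$ and $\phi^{\mathrm{mon}}=\phi_m$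 if $\rho>f(\phi_m)/2$. Duopoly ($\beta=0$): let $m(\phi):=(\Lambda f(\phi)-e)\phi$. The payoffs $\mathcal M_i=\mathcal M_i(\phi_1,\phi_2;0)$ are, for $\phi_1>\phi_2$: if $f(\phi_1)>2\rho$, $\mathcal M_1=e\phi_1$, $\mathcal M_2=e\phi_2$; if $\rho<f(\phi_1)\le2\rho$, $\mathcal M_1=m(\phi_1)$, $\mathcal M_2=e\phi_2$; if $f(\phi_1)\le\rho$, $\mathcal M_1=0$, $\mathcal M_2=\min\{e,\Lambda f(\phi_2)\}\phi_2$. For $\phi_1=\phi_2$: $\mathcal M_i=e\phi_i$ if $f(\phi_i)>2\rho$, else $\frac\Lambda2f(\phi_i)\phi_i$. For $\phi_1<\phi_2$ interchange roles. Equilibria referred to: let $\phi_b:=\max\{\phi\in[0,\phi_h]:f(\phi)+2\phi f'(\phi)\ge0\}$. If $\rho\le f(\phi_b)/2$, the equilibrium is the symmetric pure Nash equilibrium in which both platforms play $f^{-1}(2\rho)$. If $f(\phi_b)/2<\rho<1$, the equilibrium is the symmetric mixed Nash equilibrium $(\sigma^*,\sigma^* )$, where $\sigma^*$ is the probability measure supported on $[\phi_L^*,\phi_R^*]$ with $\sigma^*([\phi_L^*,\phi])=\frac{e(\phi+\phi_R^* )-\Lambda f(\phi_R^* )\phi_R^*}{2e\phi-\Lambda f(\phi)\phi}$, $\phi_L^*$ and $\phi_R^*$ being respectively the maximum value and the maximizer over $[0,\phi_h]$ of $\phi\mapsto(f(\phi)-\rho)\phi/\rho$; the same interval $[\phi_L^*,\phi_R^*]$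 is also the equilibrium cycle, and the equilibrium payoff is the expected payoff $\mathcal M_i(\sigma^*,\sigma^*;0)$. *)

(* Defs.v *)
From HB Require Import structures.
From mathcomp Require Import all_boot all_order all_algebra.
From mathcomp Require Import all_classical all_reals all_analysis.
Set Implicit Arguments.
Unset Strict Implicit.
Unset Printing Implicit Defensive.
Import Order.TTheory GRing.Theory Num.Theory.
Import numFieldNormedType.Exports.
Local Open Scope classical_set_scope.
Local Open Scope ring_scope.

(* A function on [0, phih] is the restriction of a total f : R -> R; every
   definition below reads f on [0, phih] only.  [xget x0 A] is an element of A
   when A is nonempty, the junk value x0 otherwise. *)

Definition max_of (R : realType) (A : set R) : R := xget 0 (A `&` ubound A).

Definition argmax_on (R : realType) (D : set R) (g : R -> R) : R :=
  xget 0 [set x | D x /\ forall y, D y -> g y <= g x].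

Definition max_on (R : realType) (D : set R) (g : R -> R) : R :=
  max_of (g @` D).

Definition strictly_concave_on (R : realType) (D : set R) (f : R -> R) : Prop :=
  forall x y t : R, D x -> D y -> x != y -> 0 < t < 1 ->
    t * f x + (1 - t) * f y < f (t * x + (1 - t) * y).

Definition strictly_decreasing_on (R : realType) (D : set R) (f : R -> R) :
  Prop := forall x y : R, D x -> D y -> x < y -> f y < f x.

(* Derivatives relative to D, hence one-sided at the endpoints of an interval;
   the library's [derivable] would constrain f outside D. *)
Definition differentiable_on (R : realType) (D : set R) (f : R -> R) : Prop :=
  forall x : R, D x ->
    cvg ((f y - f x) / (y - x) @[y --> within D x^']).

Definition deriv_on (R : realType) (D : set R) (f : R -> R) (x : R) : R :=
  lim ((f y - f x) / (y - x) @[y --> within D x^']).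

Definition ext_inv (R : realType) (phih : R) (f : R -> R) (x : R) : R :=
  if x < f phih then phih
  else if x <= 1 then xget 0 [set phi | phi \in `[0, phih] /\ f phi = x]
  else 0.

Definition phi_b (R : realType) (phih : R) (f : R -> R) : R :=
  max_of [set phi | phi \in `[0, phih] /\
    0 <= f phi + 2 * phi * deriv_on `[0, phih] f phi].

Definition monopoly_payoff (R : realType) (f : R -> R) (Lam e phi : R) : R :=
  if 2 * (e / Lam) < f phi then e * phi else Lam / 2 * f phi * phi.

Definition phi_mon (R : realType) (phih : R) (f : R -> R) (Lam e : R) : R :=
  argmax_on `[0, phih] (monopoly_payoff f Lam e).

(* (payoff of the platform charging hi, payoff of the one charging lo), for
   hi > lo. *)
Definition ordered_payoffs (R : realType) (f : R -> R) (Lam e hi lo : R) :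
    R * R :=
  if 2 * (e / Lam) < f hi then (e * hi, e * lo)
  else if e / Lam < f hi then ((Lam * f hi - e) * hi, e * lo)
  else (0, Num.min e (Lam * f lo) * lo).

Definition duopoly_payoff1 (R : realType) (f : R -> R) (Lam e phi1 phi2 : R) :
    R :=
  if phi2 < phi1 then (ordered_payoffs f Lam e phi1 phi2).1
  else if phi1 < phi2 then (ordered_payoffs f Lam e phi2 phi1).2
  else if 2 * (e / Lam) < f phi1 then e * phi1 else Lam / 2 * f phi1 * phi1.

Definition duopoly_payoff2 (R : realType) (f : R -> R) (Lam e phi1 phi2 : R) :
    R :=
  if phi2 < phi1 then (ordered_payoffs f Lam e phi1 phi2).2
  else if phi1 < phi2 then (ordered_payoffs f Lam e phi2 phi1).1
  else if 2 * (e / Lam) < f phi2 then e * phi2 else Lam / 2 * f phi2 * phi2.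

Definition phi_L (R : realType) (phih : R) (f : R -> R) (Lam e : R) : R :=
  max_on `[0, phih] (fun phi => (f phi - e / Lam) * phi / (e / Lam)).

Definition phi_R (R : realType) (phih : R) (f : R -> R) (Lam e : R) : R :=
  argmax_on `[0, phih] (fun phi => (f phi - e / Lam) * phi / (e / Lam)).

Definition is_sigma_star (R : realType) (phih : R) (f : R -> R) (Lam e : R)
    (sigma : probability (measurableTypeR R) R) : Prop :=
  let pL := phi_L phih f Lam e in
  let pR := phi_R phih f Lam e in
  sigma (~` [set` `[pL, pR]]) = 0%E /\
  forall phi : R, phi \in `[pL, pR] ->
    sigma [set` `[pL, phi]] =
      ((e * (phi + pR) - Lam * f pR * pR) /
       (2 * e * phi - Lam * f phi * phi))%:E.

(* Expectation of u at a pair of independent prices drawn from sigma.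
   Prices range over [0, phih], outside which payoffs are meaningless. *)
Definition expected_payoff (R : realType) (phih : R)
    (sigma : probability (measurableTypeR R) R) (u : R -> R -> R) : \bar R :=
  (\int[sigma \x sigma]_(p in [set` `[0%R, phih]] `*` [set` `[0%R, phih]])
     (u p.1 p.2)%:E)%E.

(* Main.v *)
(** The monopoly payoff is [min(e, Lam/2 f(phi)) phi], hence continuous, and it
    equals [e phi], which is increasing, as long as [f(phi) > 2 rho]; so its
    maximizer lies at or above [f^-1(2 rho)]. Whatever the two prices, the two
    duopoly payoffs add up to at most twice the better of the two corresponding
    monopoly payoffs. Since the game is symmetric, each platform therefore earns
    at most the monopoly optimum in expectation under any symmetric profile
    [(sigma, sigma)]. *)
Require Import Defs.
From HB Require Import structures.
From mathcomp Require Import all_boot all_order all_algebra.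
From mathcomp Require Import all_classical all_reals all_analysis.
From mathcomp Require Import measurable_realfun ring lra.
Import Order.TTheory GRing.Theory Num.Theory.
Import numFieldNormedType.Exports.
Local Open Scope classical_set_scope.
Local Open Scope ring_scope.

(** * Continuity relative to the domain, and attained maxima *)

Lemma differentiable_on_continuous (R : realType) (D : set R) (f : R -> R) :
  differentiable_on D f -> {within D, continuous f}.
Proof.
move=> df; apply/subspace_continuousP => x Dx.
have cid : y - x @[y --> within D x^'] --> (0 : R).
  rewrite -[0](subrr x); apply: cvgB; last exact: cvg_cst.
  by move=> A; rewrite /= /within /= /dnbhs /within /=;
    apply: filterS => y Ay _ _.
(* The difference quotient converges to a finite limit and [y - x] to 0, so their product, which is
   [f y - f x] away from [x], tends to 0. The deleted neighbourhood says nothing at [y = x], a case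
   treated separately below. *)
have fx0 : ((f y - f x) / (y - x)) * (y - x) @[y --> within D x^'] --> (0 : R).
  by rewrite -(mulr0 (lim ((f y - f x) / (y - x) @[y --> within D x^'])));
    apply: cvgM cid; exact: df.
apply/cvgrPdist_lt => eps eps0.
move/cvgrPdist_lt : fx0 => /(_ _ eps0); rewrite !near_withinE => H.
near=> y => Dy.
have [->|yx] := eqVneq y x; first by rewrite subrr normr0.
have : D y -> `|0 - (f y - f x) / (y - x) * (y - x)| < eps.
  by move: (yx); near: y.
by move/(_ Dy); rewrite divfK ?subr_eq0// sub0r opprB.
Unshelve. all: by end_near. Qed.

Lemma max_onE (R : realType) (D : set R) (g : R -> R) (c : R) :
  D c -> (forall y, D y -> g y <= g c) -> max_on D g = g c.
Proof.
move=> Dc gc; rewrite /max_on /max_of; set A := (X in xget _ X).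
have Ac : A (g c) by split; [exists c | move=> _ [y Dy <-]; exact: gc].
have [[y Dy gy] uby] : A (xget 0 A) by apply: xgetPex; exists (g c).
by apply/eqP; rewrite eq_le uby ?andbT -?gy ?gc//; exists c.
Qed.

Lemma argmax_onP (R : realType) (D : set R) (g : R -> R) (c : R) :
  D c -> (forall y, D y -> g y <= g c) ->
  D (argmax_on D g) /\ forall y, D y -> g y <= g (argmax_on D g).
Proof.
move=> Dc gc; pose A : set R := [set x | D x /\ forall y, D y -> g y <= g x].
by have : A (xget 0 A) by apply: xgetPex; exists c.
Qed.

(** * The monopoly payoff as a minimum *)

Lemma monopoly_payoffE (R : realType) (f : R -> R) (Lam e phi : R) :
  0 < Lam ->
  monopoly_payoff f Lam e phi = Num.min e (Lam / 2 * f phi) * phi.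
Proof.
move=> Lam0; rewrite /monopoly_payoff.
have -> : (2 * (e / Lam) < f phi) = (e < Lam / 2 * f phi).
  by rewrite mulrA ltr_pdivrMr// [in RHS]mulrAC ltr_pdivlMr// mulrC
    [f _ * _]mulrC.
by rewrite minElt; case: ifPn.
Qed.

(** The two branches of the payoff agree where [f phi = 2 * (e / Lam)]; the minimum form makes this
    visible. Continuity is what provides a maximizer. *)
Lemma monopoly_payoff_continuous (R : realType) (D : set R) (f : R -> R)
    (Lam e : R) :
  0 < Lam -> {within D, continuous f} ->
  {within D, continuous (monopoly_payoff f Lam e)}.
Proof.
move=> Lam0 cf x.
have -> : monopoly_payoff f Lam e =
    (fun phi => Num.min e (Lam / 2 * f phi) * phi).
  by apply/funext => phi; exact: monopoly_payoffE.
have cstc (c : R) : {within D, continuous (cst c : R -> R)}.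
  by apply: continuous_subspaceT; exact: cst_continuous.
have cid : {within D, continuous (id : R -> R)}.
  by apply: continuous_subspaceT; move=> ?; exact: cvg_id.
have cg : {within D, continuous (fun y => Lam / 2 * f y)}.
  by move=> y; exact: cvgM (cstc _ y) (cf y).
exact: cvgM (@continuous_min R (subspace D) (cst e) _ x (cstc e x) (cg x))
  (cid x).
Qed.

(** * Pointwise bounds on the duopoly payoffs *)

Lemma duopoly_payoff2E (R : realType) (f : R -> R) (Lam e x y : R) :
  duopoly_payoff2 f Lam e x y = duopoly_payoff1 f Lam e y x.
Proof. by rewrite /duopoly_payoff1 /duopoly_payoff2; case: ltgtP. Qed.

(** If [hi] serves customers, replacing [lo] by [hi] in the term [e * lo] bounds the sum by twice
    the monopoly payoff at [hi]. Otherwise only [lo] earns, and [min(e, Lam f(lo))] is at most twice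
    [min(e, Lam/2 f(lo))]. *)
Lemma ordered_payoffs_sum_le (R : realType) (f : R -> R) (Lam e hi lo : R) :
  0 < Lam -> 0 < e -> 0 <= lo <= hi ->
  (ordered_payoffs f Lam e hi lo).1 + (ordered_payoffs f Lam e hi lo).2 <=
  2 * Num.max (monopoly_payoff f Lam e hi) (monopoly_payoff f Lam e lo).
Proof.
move=> Lam0 e0 /andP[lo0 lohi]; rewrite /ordered_payoffs.
have ehilo : e * lo <= e * hi by rewrite ler_pM2l.
case: ifPn => [f2|f2] /=.
  apply: (@le_trans _ _ (2 * monopoly_payoff f Lam e hi)).
    by rewrite /monopoly_payoff f2; lra.
  by rewrite ler_pM2l// le_max lexx.
case: ifPn => [f1|f1] /=.
  apply: (@le_trans _ _ (2 * monopoly_payoff f Lam e hi)).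
    by rewrite /monopoly_payoff (negbTE f2); lra.
  by rewrite ler_pM2l// le_max lexx.
apply: (@le_trans _ _ (2 * monopoly_payoff f Lam e lo)); last first.
  by rewrite ler_pM2l// le_max lexx orbT.
rewrite add0r monopoly_payoffE// mulrA ler_wpM2r//.
have [|] := leP e (Lam / 2 * f lo); last by rewrite ge_min; lra.
by rewrite ge_min; lra.
Qed.

Lemma duopoly_payoff_sum_le (R : realType) (f : R -> R) (Lam e x y : R) :
  0 < Lam -> 0 < e -> 0 <= x -> 0 <= y ->
  duopoly_payoff1 f Lam e x y + duopoly_payoff2 f Lam e x y <=
  2 * Num.max (monopoly_payoff f Lam e x) (monopoly_payoff f Lam e y).
Proof.
move=> Lam0 e0 x0 y0; rewrite /duopoly_payoff1 /duopoly_payoff2.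
case: ltgtP => [yx|xy|->].
- by apply: ordered_payoffs_sum_le => //; rewrite y0 ltW.
- by rewrite addrC maxC; apply: ordered_payoffs_sum_le => //; rewrite x0 ltW.
- by rewrite maxxx /monopoly_payoff; case: ifP => _; lra.
Qed.

Lemma duopoly_payoff1_ge0 (R : realType) (f : R -> R) (Lam e x y : R) :
  0 < Lam -> 0 < e -> 0 <= x -> 0 <= y -> 0 <= f x ->
  0 <= duopoly_payoff1 f Lam e x y.
Proof.
move=> Lam0 e0 x0 y0 fx0; rewrite /duopoly_payoff1 /ordered_payoffs.
have ex0 : 0 <= e * x by rewrite mulr_ge0// ltW.
case: ltgtP => _.
- case: ifPn => _ //=; case: ifPn => //= + ; rewrite ltr_pdivrMr// => ?.
  by rewrite mulr_ge0// subr_ge0 ltW// mulrC.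
- case: ifPn => _ //=; case: ifPn => //= _.
  by rewrite mulr_ge0// le_min (ltW e0) mulr_ge0// ltW.
- by case: ifPn => // _; rewrite !mulr_ge0// ?invr_ge0// ltW.
Qed.

(** * Lower bounds on a monopoly maximizer *)

Lemma ext_inv_le_argmax (R : realType) (phih : R) (f : R -> R) (Lam e x : R) :
  0 <= phih -> 0 < Lam -> 0 < e ->
  strictly_decreasing_on `[0, phih] f -> x \in `[0, phih] ->
  (forall y, y \in `[0, phih] ->
     monopoly_payoff f Lam e y <= monopoly_payoff f Lam e x) ->
  ext_inv phih f (2 * (e / Lam)) <= x.
Proof.
move=> h0 Lam0 e0 df xD xmax; have /andP[x0 xh] : 0 <= x <= phih by [].
set p := ext_inv _ _ _.
have [// |xp] := leP p x.
(* Since [0 <= x < p], the value 0 of [ext_inv] is excluded, whether it comes from the branch above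
   1 or from the default of [xget]. *)
have [pD fp] : p \in `[0, phih] /\ 2 * (e / Lam) <= f p.
  move: xp; rewrite /p /ext_inv; case: ifPn => [fh _|_].
    by rewrite in_itv/= h0 lexx ltW.
  case: ifPn => [_|_]; last by rewrite ltNge x0.
  by case: xgetP => [y _ [yD ->]|_]; last rewrite ltNge x0.
(* Hence [x] earns [e * x]. Also [p] earns [e * p], by agreement of the two branches if
   [f p = 2 * (e / Lam)]. This is strictly more, a contradiction. *)
have fpx : 2 * (e / Lam) < f x.
  by apply: le_lt_trans fp _; exact: df.
(* The goal is [false]; rewriting backwards with the optimality of [x] turns it into the claim that
   [p] earns strictly more. *)
have := xmax _ pD; rewrite /monopoly_payoff fpx => /le_gtF <-.
case: ifPn => [_|]; first by rewrite ltr_pM2l.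
rewrite -leNgt => fp'; have {fp fp'} -> : f p = 2 * (e / Lam).
  by apply/eqP; rewrite eq_le fp' fp.
have -> : Lam / 2 * (2 * (e / Lam)) = e by field; rewrite lt0r_neq0.
by rewrite ltr_pM2l.
Qed.

(* If [x < phi_R], optimality of [phi_R] gives
   [f(phi_R) phi_R - f(x) x >= rho (phi_R - x) > 0], so both terms of
   [min (e phi, Lam/2 f(phi) phi)] are larger at [phi_R] than at [x]. *)
Lemma phi_R_le_argmax (R : realType) (phih : R) (f : R -> R) (Lam e x : R) :
  0 <= phih -> 0 < Lam -> 0 < e -> x \in `[0, phih] ->
  (forall y, y \in `[0, phih] ->
     monopoly_payoff f Lam e y <= monopoly_payoff f Lam e x) ->
  phi_R phih f Lam e <= x.
Proof.
move=> h0 Lam0 e0 xD xmax; have /andP[x0 _] : 0 <= x <= phih by [].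
(* If there were no maximizer, [phi_R] would be the default 0, which is at most [x]. *)
rewrite /phi_R /argmax_on; case: xgetP => // p _ [pD pmax].
have [// |xp] := leP p x.
have rho0 : 0 < e / Lam by rewrite divr_gt0.
have := pmax _ xD; rewrite ler_pM2r ?invr_gt0// => gxp.
have p0 : 0 <= p by case/andP: (pD : 0 <= p <= phih).
have exp : e * x < e * p by rewrite ltr_pM2l.
have fxp : Lam / 2 * f x * x < Lam / 2 * f p * p.
  rewrite -!mulrA !ltr_pM2l ?invr_gt0//.
  have : e / Lam * x < e / Lam * p by rewrite ltr_pM2l.
  by lra.
have := xmax _ pD; rewrite !monopoly_payoffE// !minr_pMl// => /le_gtF <-.
by rewrite lt_min !gt_min exp fxp orbT.
Qed.

(** * Measurability and expected payoffs *)

Lemma measurable_duopoly_payoff1 (R : realType) (f : R -> R) (Lam e : R) :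
  measurable_fun [set: R] f ->
  measurable_fun [set: R * R] (fun p => duopoly_payoff1 f Lam e p.1 p.2).
Proof.
move=> mf.
have mf1 : measurable_fun [set: R * R] (fun p => f p.1).
  exact: measurableT_comp mf measurable_fst.
have mf2 : measurable_fun [set: R * R] (fun p => f p.2).
  exact: measurableT_comp mf measurable_snd.
have m1 : measurable_fun [set: R * R] fst := measurable_fst.
have m2 : measurable_fun [set: R * R] snd := measurable_snd.
have mord : measurable_fun [set: R * R]
    (fun p => ordered_payoffs f Lam e p.1 p.2).
  apply: measurable_fun_ifT; first exact: measurable_fun_ltr.
    by apply: measurable_fun_pair; exact: measurable_funM.
  apply: measurable_fun_ifT; first exact: measurable_fun_ltr.
    apply: measurable_fun_pair; apply: measurable_funM => //.
    by apply: measurable_funB => //; exact: measurable_funM.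
  apply: measurable_fun_pair => //; apply: measurable_funM => //.
  by apply: measurable_minr => //; exact: measurable_funM.
have mswap : measurable_fun [set: R * R] (fun p => (p.2, p.1)).
  exact: measurable_fun_pair.
apply: measurable_fun_ifT; first exact: measurable_fun_ltr.
  exact: measurableT_comp measurable_fst mord.
apply: measurable_fun_ifT; first exact: measurable_fun_ltr.
  exact: measurableT_comp measurable_snd (measurableT_comp mord mswap).
apply: measurable_fun_ifT; first exact: measurable_fun_ltr.
  exact: measurable_funM.
by apply: measurable_funM => //; exact: measurable_funM.
Qed.

(** On [D * D] the payoff reads [f] at points of [D] only, so [f] may be replaced by its extension
    by zero, which is measurable everywhere. *)
Lemma measurable_duopoly_payoff1_within (R : realType) (D : set R) (f : R -> R)
    (Lam e : R) :
  measurable D -> measurable_fun D f ->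
  measurable_fun (D `*` D) (fun p => duopoly_payoff1 f Lam e p.1 p.2).
Proof.
move=> mD /(measurable_restrictT f mD) mf.
apply: (@eq_measurable_fun _ _ _ _ _
    (fun p => duopoly_payoff1 (f \_ D) Lam e p.1 p.2)).
  move=> [x y]; rewrite inE => -[/= Dx Dy].
  by rewrite /duopoly_payoff1 /ordered_payoffs !patchE !mem_set.
by apply: measurable_funTS; exact: measurable_duopoly_payoff1.
Qed.

(** The two prices have the same law, so Tonelli's theorem for nonnegative integrands allows
    exchanging them. *)
Lemma expected_payoff_swap (R : realType) (phih : R)
    (sigma : probability (measurableTypeR R) R) (u v : R -> R -> R) :
  let D := [set` `[0, phih]] in
  measurable_fun (D `*` D) (fun p => u p.1 p.2) ->
  (forall x y, D x -> D y -> 0 <= u x y) ->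
  (forall x y, v x y = u y x) ->
  expected_payoff phih sigma v = expected_payoff phih sigma u.
Proof.
move=> D mu u_ge0 uv.
have mDD : measurable (D `*` D : set (measurableTypeR R * measurableTypeR R)).
  by apply: measurableX; exact: measurable_itv.
(* The square becomes part of the integrand, extended by zero, so that Tonelli applies on the whole
   product. *)
rewrite /expected_payoff integral_mkcond [RHS]integral_mkcond.
set gv := (X in integral _ _ X = _); set gu := (X in _ = integral _ _ X).
have gvu x y : gv (x, y) = gu (y, x).
  rewrite /gv /gu !patchE /= uv; congr (if _ then _ else _).
  by apply/idP/idP; rewrite !inE => -[].
have gu0 p : (0 <= gu p)%E.
  rewrite /gu patchE; case: ifPn => //; rewrite inE => -[? ?].
  by rewrite lee_fin u_ge0.
have mgu : measurable_fun setT gu.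
  by apply/(measurable_restrictT _ mDD); exact/measurable_EFinP.
have mgv : measurable_fun setT gv.
  have -> : gv = gu \o (fun p => (p.2, p.1)).
    by apply/funext => -[x y]; exact: gvu.
  by apply: (measurableT_comp mgu); exact: measurable_fun_pair.
rewrite (fubini_tonelli1 _ mgv); last by move=> [x y]; rewrite gvu.
rewrite fubini_tonelli2//; apply: eq_integral => x _.
by apply: eq_integral => y _; exact: gvu.
Qed.

(* By symmetry both expected payoffs are half of the expected sum. *)
Lemma expected_payoff_le (R : realType) (phih : R)
    (sigma : probability (measurableTypeR R) R) (u v : R -> R -> R) (V : R) :
  let D := [set` `[0, phih]] in
  measurable_fun (D `*` D) (fun p => u p.1 p.2) ->
  (forall x y, D x -> D y -> 0 <= u x y) ->
  (forall x y, v x y = u y x) ->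
  0 <= V ->
  (forall x y, D x -> D y -> u x y + v x y <= 2 * V) ->
  (expected_payoff phih sigma u <= V%:E)%E.
Proof.
move=> D mu u_ge0 uv V0 uvV.
have mDD : measurable (D `*` D : set (measurableTypeR R * measurableTypeR R)).
  by apply: measurableX; exact: measurable_itv.
have mv : measurable_fun (D `*` D) (fun p => v p.1 p.2).
  apply: (@eq_measurable_fun _ _ _ _ _
      ((fun p => u p.1 p.2) \o (fun p => (p.2, p.1)))).
    by move=> p _ /=; rewrite uv.
  apply: measurable_comp mu _ => //; first by move=> _ [[x y] [? ?] <-].
  by apply: measurable_funTS; exact: measurable_fun_pair.
have : (expected_payoff phih sigma u + expected_payoff phih sigma v <=
    (2 * V)%:E)%E.
  rewrite -ge0_integralD//; last 4 first.
  - by move=> p [? ?]; rewrite lee_fin u_ge0.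
  - exact/measurable_EFinP.
  - by move=> p [? ?]; rewrite lee_fin uv u_ge0.
  - exact/measurable_EFinP.
  apply: (@le_trans _ _ (\int[sigma \x sigma]_(p in D `*` D) (2 * V)%:E)%E).
    apply: ge0_le_integral => //.
    - move=> p [? ?]; rewrite -EFinD lee_fin addr_ge0// ?uv u_ge0//.
    - by apply: emeasurable_funD; exact/measurable_EFinP.
    - by move=> p [? ?]; rewrite -EFinD lee_fin uvV.
  (* The constant integrates to [2 * V] times the squared mass of [D], which is at most 1. *)
  have -> : (\int[sigma \x sigma]_(p in D `*` D) (2 * V)%:E)%E =
      ((2 * V)%:E * (sigma D * sigma D))%E.
    rewrite integral_cst//; congr *%E.
    by apply: product_measure1E; exact: measurable_itv.
  rewrite -[leRHS]mule1 lee_wpmul2l ?lee_fin ?mulr_ge0// -[leRHS]mule1.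
  by apply: lee_pmul => //; apply: probability_le1; exact: measurable_itv.
rewrite (expected_payoff_swap _ _ _ _ _ mu)//.
(* The bound on the doubled expectation rules out an infinite positive value, and the finite case is
   halved. *)
case: (expected_payoff phih sigma u) => [r|//|_]; last by rewrite leNye.
by rewrite -EFinD !lee_fin; lra.
Qed.

(** * Comparison in the three regimes of [rho] *)

Theorem lemma6 (R : realType) (phih : R) (f : R -> R) (Lam e : R)
    (phih_gt0 : 0 < phih)
    (f_concave : strictly_concave_on `[0, phih] f)
    (f_decr : strictly_decreasing_on `[0, phih] f)
    (f_diff : differentiable_on `[0, phih] f)
    (f_range : forall phi : R, phi \in `[0, phih] -> 0 < f phi <= 1)
    (f_at0 : f 0 = 1)
    (Lam_gt0 : 0 < Lam) (e_gt0 : 0 < e) :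
  let rho := e / Lam in
  let monopoly_price := phi_mon phih f Lam e in
  let monopoly_opt := max_on `[0, phih] (monopoly_payoff f Lam e) in
  let M1 := duopoly_payoff1 f Lam e in
  let M2 := duopoly_payoff2 f Lam e in
  let threshold := f (phi_b phih f) / 2 in
  [/\ (* pure equilibrium *)
      rho <= threshold ->
        let p := ext_inv phih f (2 * rho) in
        [/\ p <= monopoly_price, M1 p p <= monopoly_opt
          & M2 p p <= monopoly_opt],
      (* mixed equilibrium / equilibrium cycle *)
      threshold < rho < 1 ->
        (forall phi : R,
           phi \in `[phi_L phih f Lam e, phi_R phih f Lam e] ->
           phi <= monopoly_price) /\
        (forall sigma : probability (measurableTypeR R) R,
           is_sigma_star phih f Lam e sigma ->
           (expected_payoff phih sigma M1 <= monopoly_opt%:E)%E /\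
           (expected_payoff phih sigma M2 <= monopoly_opt%:E)%E)
    & (* zero duopoly price and payoff *)
      1 <= rho -> 0 <= monopoly_price /\ 0 <= monopoly_opt].
Proof.
move=> rho price opt M1 M2 threshold.
have h0 := ltW phih_gt0.
have D0 : (0 : R) \in `[0, phih] by rewrite in_itv/= lexx.
have ge0 x : x \in `[0, phih] -> 0 <= x by rewrite in_itv => /andP[].
have cf := differentiable_on_continuous _ _ _ f_diff.
(* An attained maximum makes [price] a true maximizer instead of the default 0. *)
have [c cD cmax] :=
  EVT_max h0 (monopoly_payoff_continuous _ _ _ _ e Lam_gt0 cf).
have [priceD pricemax] : price \in `[0, phih] /\ forall y, y \in `[0, phih] ->
    monopoly_payoff f Lam e y <= monopoly_payoff f Lam e price.
  exact: argmax_onP cD cmax.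
have optE : opt = monopoly_payoff f Lam e price by exact: max_onE.
(* A zero price earns zero. *)
have opt0 : 0 <= opt.
  by rewrite optE -[leLHS](mulr0 (Num.min e (Lam / 2 * f 0)))
    -monopoly_payoffE// pricemax.
split.
- move=> _ p.
  have pD : p \in `[0, phih].
    rewrite /p /ext_inv; case: ifPn => _; first by rewrite in_itv/= h0 lexx.
    by case: ifPn => _ //; case: xgetP => // y _ [].
  have Mp : M1 p p = monopoly_payoff f Lam e p.
    by rewrite /M1 /duopoly_payoff1 ltxx.
  by split; [exact: ext_inv_le_argmax|rewrite Mp optE pricemax|
    rewrite /M2 duopoly_payoff2E -/M1 Mp optE pricemax].
- move=> _; split=> [phi|sigma _].
    rewrite in_itv => /andP[_ phiR]; apply: le_trans phiR _.
    exact: phi_R_le_argmax.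
  have M1_meas : measurable_fun ([set` `[0, phih]] `*` [set` `[0, phih]])
      (fun p => M1 p.1 p.2).
    apply: measurable_duopoly_payoff1_within; first exact: measurable_itv.
    apply: subspace_continuous_measurable_fun => //; exact: measurable_itv.
  have M1_ge0 x y : x \in `[0, phih] -> y \in `[0, phih] -> 0 <= M1 x y.
    move=> xD yD; have /andP[/ltW fx0 _] := f_range _ xD.
    by apply: duopoly_payoff1_ge0 => //; exact: ge0.
  have M21 x y : M2 x y = M1 y x by exact: duopoly_payoff2E.
  (* Both platforms now have the same expected payoff, so one bound suffices. *)
  rewrite (expected_payoff_swap _ _ _ _ _ M1_meas)//.
  suff : (expected_payoff phih sigma M1 <= opt%:E)%E by [].
  apply: (expected_payoff_le _ _ _ _ _ _ M1_meas _ M21 opt0) => // x y xD yD.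
  apply: le_trans (duopoly_payoff_sum_le _ _ _ _ _ _ _ _ _ _) _; rewrite ?ge0//.
  by rewrite ler_pM2l// ge_max optE !pricemax.
- by move=> _; rewrite ge0.
Qed.
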